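(* Let $b\in S=[L^1(0,1)]^q$, let $(\hat b_n)_{n\in\mathbb{N}}$ be a sequence of estimators of $b$ with values in $S$, let $0=\lambda_0<\lambda_1<\dots<\lambda_K=1$, and for $k=1,\dots,K$ let $B_k=\int_{\lambda_{k-1}}^{\lambda_k} b(p)\,\mathrm{d}p$ and $\hat B_{k,n}=\int_{\lambda_{k-1}}^{\lambda_k}\hat b_n(p)\,\mathrm{d}p$ (integrals taken coordinate-wise). If $\hat b_n$ is a consistent estimator of $b$ in $S$, i.e. $\lim_{n\to\infty}\Pr(\lVert\hat b_n-b\rVert_S>\varepsilon)=0$ for every $\varepsilon>0$, then $\hat B_{k,n}$ is a consistent estimator of $B_k$, i.e. $\lim_{n\to\infty}\Pr(\lVert\hat B_{k,n}-B_k\rVert_\infty>\varepsilon)=0$ for every $\varepsilon>0$, for $k=1,\dots,K$.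
   Context: $S=[L^1(0,1)]^q$ is the $q$-dimensional product of $L^1(0,1)$ with norm $\lVert b\rVert_S=\sum_{i=1}^q\lVert b^i\rVert_{L^1}$; $\lVert\cdot\rVert_\infty$ is the maximum norm on $\mathbb{R}^q$. The setting: $Y_1,\dots,Y_n$ are independent replicates of a real random variable $Y$ with $\mathrm{E}(Y)<\infty$, with fixed given covariate vectors $x_1,\dots,x_n\in\mathbb{R}^m$; the conditional quantile function of $Y$ given $x$ is modeled as $Q(p|x)=t(x)^Tb(p)$, with $t:\mathbb{R}^m\to\mathbb{R}^q$ a transformation of $x$ and $b:(0,1)\to\mathbb{R}^q$ coordinate-wise integrable. An estimator $\hat b_n$ is a random element of $S$ computed from the sample $\{(Y_j,x_j)\}_{j=1}^n$. *)

(* Defs.v *)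
From HB Require Import structures.
From mathcomp Require Import all_boot all_order all_algebra.
From mathcomp Require Import all_classical all_reals all_analysis.
From mathcomp Require Import measurable_realfun.

Set Implicit Arguments.
Unset Strict Implicit.
Unset Printing Implicit Defensive.

Import Order.TTheory GRing.Theory Num.Theory.
Import numFieldNormedType.Exports.

Local Open Scope classical_set_scope.
Local Open Scope ring_scope.

(* Lebesgue measure on (0, 1), carried by the whole line: every set is first
   intersected with ]0, 1[, so values outside ]0, 1[ are irrelevant. *)
Definition leb01 (R : realType) : {measure set (measurableTypeR R) -> \bar R} :=
  mrestr (@lebesgue_measure R) (measurable_itv `]0 : R, 1[).

(* The elements of L1_01 R are almost-everywhere classes; they coerce to
   functions through a chosen representative. *)
Definition L1_01 (R : realType) : Type := LspaceType1 (leb01 R).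

Definition L1fun (R : realType) (f : L1_01 R) : R -> R := f.

Definition L1q (R : realType) (q : nat) : Type := 'I_q -> L1_01 R.

Definition L1q_norm (R : realType) (q : nat) (f : 'I_q -> R -> R) : R :=
  \sum_(i < q) fine ('N[leb01 R]_1[EFin \o f i])%E.

Definition L1q_sub (R : realType) (q : nat) (a b : L1q R q) : 'I_q -> R -> R :=
  fun i => L1fun (a i) \- L1fun (b i).


Lemma L1fun_Lfun (R : realType) (f : L1_01 R) : L1fun f \in Lfun (leb01 R) 1.
Proof.
rewrite inE; apply/andP; split; rewrite inE /=.
  exact: (@measurable_funPT _ _ _ _ (repr (LebesgueSpace.sort f))).
exact: (@Lebesgue_finite _ _ _ _ _ _ f).
Qed.

Lemma L1_01_eq (R : realType) (f g : L1_01 R) :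
  L1fun f = L1fun g %[ae leb01 R] -> f = g.
Proof.
move=> fg; have : LebesgueSpace.sort f = LebesgueSpace.sort g.
  rewrite -[LHS]reprK -[RHS]reprK; apply/eqmodP.
  exact/asboolP.
case: f g {fg} => [f [[fF]]] [g [[gF]]] /= fg; subst g.
by rewrite (bool_irrelevance fF gF).
Qed.

Section L1_01_zero.
Context (R : realType).

Let zero_class : {mfun_ leb01 R, measurableTypeR R >-> measurableTypeR R} :=
  (\pi_(aeEqMfun _ (leb01 R))
     (cst 0 : {mfun measurableTypeR R >-> measurableTypeR R}))%qT.

Let z : R -> R := zero_class.

Let zero_class_finite : finite_norm (leb01 R) 1%E zero_class.
Proof.
have mz : measurable_fun [set: R] (EFin \o z).
  apply/measurable_EFinP.
  exact: (@measurable_funPT _ _ _ _ (repr zero_class)).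
have /asboolP z0 : ae_eq_op (leb01 R) (repr zero_class) (cst 0).
  by apply/eqmodP; rewrite reprK.
rewrite /finite_norm Lnorm1 -/z.
have -> : (\int[leb01 R]_x `|(EFin \o z) x| = \int[leb01 R]_x 0)%E.
  apply: ae_eq_integral => //; first exact: measurableT_comp.
  apply: filterS z0 => x /= /(_ I) + _.
  by rewrite /z /aqEqMfun_to_fun /= => ->; rewrite normr0.
by rewrite integral0.
Qed.

HB.instance Definition _ :=
  @isFinLebesgue.Build _ _ _ (leb01 R) 1%E (lexx _) zero_class
    zero_class_finite.

Definition L1_01_0 : L1_01 R := zero_class.

End L1_01_zero.

Section L1q_metric.
Context (R : realType) (q : nat).
Implicit Types a b c : L1q R q.

Let mu := leb01 R.
Let nrm (f : R -> R) : R := fine ('N[mu]_1[EFin \o f])%E.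

Let subL (f g : R -> R) : f \in Lfun mu 1 -> g \in Lfun mu 1 ->
  f \- g \in Lfun mu 1.
Proof. by move=> fL gL; rewrite (_ : f \- g = f - g)//; apply: rpredB. Qed.

Let nrmE (f : R -> R) : f \in Lfun mu 1 -> (nrm f)%:E = ('N[mu]_1[EFin \o f])%E.
Proof. by move=> fL; exact: (@finite_norm_fine _ _ _ mu _ (lexx _) (Lfun_Sub _ fL)). Qed.

Let dist a b := L1q_norm (L1q_sub a b).

Let dxx a : dist a a = 0.
Proof.
rewrite /dist /L1q_norm big1// => i _.
rewrite (_ : EFin \o _ = cst 0%E) ?Lnorm0//.
by apply/funext => p /=; rewrite /L1q_sub /= subrr.
Qed.

Let dsym a b : dist a b = dist b a.
Proof.
apply: eq_bigr => i _; congr fine; rewrite -oppe_Lnorm; apply: eq_Lnorm => p.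
by rewrite /L1q_sub /= opprB.
Qed.

Let dtri b a c : dist a c <= dist a b + dist b c.
Proof.
rewrite /dist /L1q_norm -big_split /=; apply: ler_sum => i _.
rewrite -/(nrm _) -/(nrm _) -/(nrm _) /L1q_sub.
have [[A B] C] := (L1fun_Lfun (a i), L1fun_Lfun (b i), L1fun_Lfun (c i)).
rewrite -lee_fin EFinD !nrmE ?subL//.
have -> : L1fun (a i) \- L1fun (c i) =
    (L1fun (a i) \- L1fun (b i)) \+ (L1fun (b i) \- L1fun (c i)).
  by apply/funext => p /=; rewrite addrA subrK.
have /Lfun1_integrable/measurable_int/measurable_EFinP mAB := subL A B.
have /Lfun1_integrable/measurable_int/measurable_EFinP mBC := subL B C.
exact: eminkowski.
Qed.

Let dpos a b : dist a b = 0 -> a = b.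
Proof.
move=> /eqP; rewrite psumr_eq0; last first.
  by move=> i _; rewrite fine_ge0 ?Lnorm_ge0.
move=> /allP ab0; apply/funext => i.
have /implyP/(_ isT)/eqP n0 := ab0 i (mem_index_enum i).
have abL := subL (L1fun_Lfun (a i)) (L1fun_Lfun (b i)).
have {}n0 := @fine_Lnormr_eq0 _ _ _ mu _ (lexx _) (Lfun_Sub _ abL) n0.
apply: L1_01_eq; apply: filterS n0 => p /= /(_ I) /eqP.
by rewrite subr_eq0 => /eqP + _.
Qed.

HB.instance Definition _ := gen_eqMixin (L1q R q).
HB.instance Definition _ := gen_choiceMixin (L1q R q).
HB.instance Definition _ := isPointed.Build (L1q R q) (fun=> L1_01_0 R).
HB.instance Definition _ := isMetric.Build R (L1q R q) dxx dpos dsym dtri.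

End L1q_metric.

(* The Borel sigma-algebra of the norm topology: {RV P >-> L1q_borel R q} is the
   type of random elements of L1q R q. *)
Notation L1q_borel R q := (g_sigma_algebraType (@open (L1q R q))).

Definition L1q_integral (R : realType) (q : nat) (b : L1q R q) (l r : R) :
    'rV[R]_q :=
  \row_(i < q) \int[@lebesgue_measure R]_(p in `]l, r[) L1fun (b i) p.

Definition mutually_independent (d : measure_display) (T : measurableType d)
    (R : realType) (P : probability T R) (Y : nat -> {RV P >-> R}) : Prop :=
  forall (n : nat) (A : 'I_n -> set R), (forall j, measurable (A j)) ->
  P (\bigcap_(j in [set: 'I_n]) Y j @^-1` A j) =
  (\prod_(j < n) P (Y j @^-1` A j))%E.

Definition quantile (R : realType) (nu : probability R R) (p : R) : R :=
  inf [set y : R | (p%:E <= nu `]-oo, y]%classic)%E].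

(* condY v is the law of the response given the covariate vector v; b is only
   defined up to a null set, hence the model equation at almost every p. *)
Record quantile_model (d : measure_display) (T : measurableType d)
    (R : realType) (P : probability T R) (m q : nat)
    (condY : 'rV[R]_m -> probability R R) (Y : nat -> {RV P >-> R})
    (x : nat -> 'rV[R]_m) (t : 'rV[R]_m -> 'rV[R]_q) (b : L1q R q) : Prop := {
  quantile_model_independent : mutually_independent Y ;
  quantile_model_law : forall (j : nat) (A : set R), measurable A ->
    distribution P (Y j) A = condY (x j) A ;
  quantile_model_integrable : forall j : nat,
    P.-integrable [set: T] (EFin \o Y j) ;
  quantile_model_quantile : forall j : nat, {ae leb01 R, forall p : R,
    quantile (condY (x j)) p = \sum_(i < q) t (x j) ord0 i * L1fun (b i) p}
}.

Definition computed_from_sample (d : measure_display) (T : measurableType d)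
    (R : realType) (P : probability T R) (m q : nat) (Y : nat -> {RV P >-> R})
    (x : nat -> 'rV[R]_m) (n : nat) (bhat : {RV P >-> L1q_borel R q}) : Prop :=
  exists stat : ('I_n -> R * 'rV[R]_m) -> L1q R q,
    forall w : T, bhat w = stat (fun j : 'I_n => (Y j w, x j)).

(* Main.v *)
(* Coordinate-wise integration over a subinterval of (0, 1) is 1-Lipschitz from
   the L^1 norm to the maximum norm, so an event "the integrals differ by more
   than eps" is contained in the event "the L^1 distance exceeds eps". Both are
   preimages of open sets of S, hence measurable. *)
Require Import Defs.
From HB Require Import structures.
From mathcomp Require Import all_boot all_order all_algebra.
From mathcomp Require Import all_classical all_reals all_analysis.
From mathcomp Require Import measurable_realfun.

Set Implicit Arguments.
Unset Strict Implicit.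
Unset Printing Implicit Defensive.

Import Order.TTheory GRing.Theory Num.Theory.
Import numFieldNormedType.Exports.

Local Open Scope classical_set_scope.
Local Open Scope ring_scope.

(** Intersecting with []0, 1[] changes no measurable subset of [A], so [leb01 R] and Lebesgue
    measure give the same integrals over [A]. *)
Lemma leb01_integrableS (R : realType) (f : R -> R)
    (A : set (measurableTypeR R)) :
  measurable A -> A `<=` `]0, 1[ -> f \in Lfun (leb01 R) 1 ->
  (@lebesgue_measure R).-integrable A (EFin \o f).
Proof.
move=> mA A01 /Lfun1_integrable fL.
have /integrableP[mf fi] := integrableS (@measurableT _ _) mA (@subsetT _ A) fL.
apply/integrableP; split => //.
rewrite (@eq_measure_integral _ _ _ _ (leb01 R))// => B mB BA.
by rewrite /leb01 /= /mrestr setIidl//; exact: subset_trans A01.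
Qed.

(** The left side is at most the Lebesgue integral of [|f|] over [A]. There it can be taken against
    [leb01 R], and enlarging [A] to the whole line yields the L1 norm. *)
Lemma le_normr_Rintegral_leb01 (R : realType) (f : R -> R)
    (A : set (measurableTypeR R)) :
  measurable A -> A `<=` `]0, 1[ -> f \in Lfun (leb01 R) 1 ->
  `| \int[@lebesgue_measure R]_(p in A) f p | <=
  fine ('N[leb01 R]_1[EFin \o f])%E.
Proof.
move=> mA A01 fL; have fA := leb01_integrableS mA A01 fL.
apply: le_trans (le_normr_Rintegral mA fA) _.
have /Lfun1_integrable/integrableP[mf fi] := fL.
rewrite Lnorm1 /Rintegral fine_le//.
- have /integrableP[mfA] := fA; rewrite ge0_fin_numE//.
  exact: integral_ge0.
- by rewrite ge0_fin_numE//; exact: integral_ge0.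
rewrite (@eq_measure_integral _ _ _ _ (leb01 R)); last first.
  move=> B mB BA.
  by rewrite /leb01 /= /mrestr setIidl//; exact: subset_trans A01.
apply: ge0_subset_integral => //.
have /measurable_EFinP {}mf := mf.
by apply/measurable_EFinP; exact: measurableT_comp mf.
Qed.

Lemma L1q_integral_lipschitz (R : realType) (q : nat) (a b : L1q R q)
    (l r : R) : 0 <= l -> r <= 1 ->
  `| L1q_integral a l r - L1q_integral b l r | <= L1q_norm (L1q_sub a b).
Proof.
move=> l0 r1.
have norm_ge0 (i : 'I_q) :
    0 <= fine ('N[leb01 R]_1[EFin \o L1q_sub a b i])%E.
  by rewrite fine_ge0// Lnorm_ge0.
have lr01 : [set` `]l, r[ ] `<=` [set` `]0 : R, 1[ ].
  move=> p /=; rewrite !in_itv /= => /andP[lp pr].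
  by rewrite (le_lt_trans l0 lp) (lt_le_trans pr r1).
(* The maximum starts from 0, so the bound must be nonnegative (this also covers [q = 0]) besides
   dominating each coordinate. *)
rewrite [`|_|]mx_normrE; apply: bigmax_le => [|[i0 i] _].
  exact: sumr_ge0.
rewrite /= !mxE -RintegralB//; first last.
- exact: leb01_integrableS (L1fun_Lfun (b i)).
- exact: leb01_integrableS (L1fun_Lfun (a i)).
have abL : L1q_sub a b i \in Lfun (leb01 R) 1.
  rewrite /L1q_sub (_ : _ \- _ = L1fun (a i) - L1fun (b i))//.
  exact: rpredB (L1fun_Lfun _) (L1fun_Lfun _).
apply: le_trans (le_normr_Rintegral_leb01 _ lr01 abL) _ => //.
by rewrite /L1q_norm (bigD1 i)//= lerDl sumr_ge0.
Qed.

(** Moving by less than [g a - e] lowers [g] by less than that amount, so this radius gives a ball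
    inside the set. It serves to make both events of the theorem measurable. *)
Lemma open_gt_lipschitz (R : realType) (M : metricType R) (g : M -> R)
    (e : R) : (forall a a', g a <= g a' + mdist a a') ->
  open [set a | e < g a].
Proof.
move=> glip; rewrite openE => a /= ea; apply/nbhs_ballP.
exists (g a - e) => /=; first by rewrite subr_gt0.
move=> a'; rewrite ballEmdist /= ltrBrDr => aa'.
rewrite -(ltrD2r (mdist a a')) addrC.
exact: lt_le_trans aa' (glip a a').
Qed.

Theorem proposition2 (R : realType) (d : measure_display)
    (T : measurableType d) (P : probability T R) (m q : nat)
    (condY : 'rV[R]_m -> probability R R)
    (Y : nat -> {RV P >-> R}) (x : nat -> 'rV[R]_m)
    (t : 'rV[R]_m -> 'rV[R]_q) (b : L1q R q)
    (hmodel : quantile_model condY Y x t b)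
    (bhat : nat -> {RV P >-> L1q_borel R q})
    (hbhat : forall n : nat, computed_from_sample Y x n (bhat n))
    (K : nat) (lambda : nat -> R)
    (hlambda0 : lambda 0%N = 0) (hlambdaK : lambda K = 1)
    (hlambda_lt : forall k : nat, (k < K)%N -> lambda k < lambda k.+1)
    (hconsistent : forall eps : R, 0 < eps ->
      (fun n : nat => P [set w | eps < L1q_norm (L1q_sub (bhat n w) b)])
        @ \oo --> 0%E) :
  forall k : nat, (1 <= k <= K)%N ->
  forall eps : R, 0 < eps ->
    (fun n : nat => P [set w |
      eps < `| L1q_integral (bhat n w) (lambda k.-1) (lambda k) -
               L1q_integral b (lambda k.-1) (lambda k) | ])
      @ \oo --> 0%E.
Proof.
move=> k /andP[k1 kK] eps eps0.
(* Strict growth is known only between consecutive nodes up to [K]; chaining these steps places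
   every node in [[0, 1]]. *)
have lambda_le (i j : nat) : (i <= j <= K)%N -> lambda i <= lambda j.
  elim: j => [|j IH]; first by rewrite leqn0 => /andP[/eqP->].
  rewrite leq_eqVlt => /andP[/orP[/eqP->//|ij] jK].
  by rewrite (le_trans (IH _)) ?ltW ?hlambda_lt// -ltnS ij ltnW.
have l0 : 0 <= lambda k.-1.
  by rewrite -hlambda0 lambda_le//= (leq_trans (leq_pred k)).
have r1 : lambda k <= 1 by rewrite -hlambdaK lambda_le// kK leqnn.
have mpre n (A : set (L1q R q)) : open A -> measurable (bhat n @^-1` A).
  by move=> oA; apply: measurable_funPTI; exact: sub_sigma_algebra.
apply: squeeze_cvge (hconsistent eps eps0); last exact: cvg_cst.
apply: nearW => n; rewrite measure_ge0 /=.
apply: le_measure; rewrite ?inE.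
- apply: (mpre n [set a | eps < `|L1q_integral a _ _ - _|]).
  (* Insert the integral of [a'] by the triangle inequality; [mdist a a'] unfolds to the L1
     distance, which bounds the first term. *)
  apply: open_gt_lipschitz => a a'; rewrite [leRHS]addrC.
  apply: le_trans (ler_distD (L1q_integral a' (lambda k.-1) (lambda k)) _ _) _.
  by rewrite lerD2r; exact: L1q_integral_lipschitz.
- apply: (mpre n [set a | eps < L1q_norm (L1q_sub a b)]).
  (* The distance to the fixed point [b] is 1-Lipschitz. *)
  apply: open_gt_lipschitz => a a'; rewrite [leRHS]addrC.
  exact: (metric_triangle (a : L1q R q) a' b).
move=> w /= /lt_le_trans; apply.
exact: L1q_integral_lipschitz.
Qed.
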